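(* Let $G=(V,E)$ be a finite directed graph with activation probabilities $p:E\to[0,1]$, let $S\subseteq V$ be a negative seed set and $\tau\ge 0$ an integer time constraint. Let the tie-breaking rule be any one of Positive Dominance, Negative Dominance, or Fixed Dominance (with any fixed priority order $\gamma$). Then the set function $\sigma^-_\tau:2^{V\setminus S}\to\mathbb{R}$, $\sigma^-_\tau(A)=\sigma_\tau(S,\varnothing)-\sigma_\tau(S,A)$ (the objective function of the TC-AIBM problem), is submodular: for all $A\subseteq B\subseteq V\setminus S$ and all $x\in (V\setminus S)\setminus B$, $$\sigma^-_\tau(A\cup\{x\})-\sigma^-_\tau(A)\ \ge\ \sigma^-_\tau(B\cup\{x\})-\sigma^-_\tau(B).$$
   Context: Time-Critical Independent Cascade (TC-IC) model with two competing seed sets: $G=(V,E)$ is a directed graph, $p:E\to[0,1]$, $S$ is the known negative seed set, $A\subseteq V\setminus S$ the positive seed set. Every node is inactive, positively activated or negatively activated, and an activated node never changes state. At time $0$ the nodes of $S$ are negatively activated and those of $A$ positively activated. At each time $t=1,2,\dots,\tau$, every node $u$ activated at time $t-1$ makes one attempt to pass its information (positive or negative, according to its state) to each still inactive out-neighbour $v$, succeeding independently with probability $p(u,v)$; an inactive node receiving information at time $t$ becomes activated at time $t$. The process stops after time $\tau$ (or earlier if no new node is activated). Equivalently, draw a random live-edge graph $L=(V,E_L)$ by keeping each edge $e$ independently with probability $p(e)$; the attempt along $e$ succeeds if and only if $e\in E_L$. If all information a node receives at time $t$ is of one type, it takes that type. If it receives both types at the same time $t$, a tie-breaking rule decides: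 - Positive Dominance: it becomes positively activated; - Negative Dominance: it becomes negatively activated; - Fixed Dominance: a predetermined priority order, i.e. an injective function $\gamma$ on $V$ with values in a totally ordered set, is fixed; each piece of information carries the priority of the seed it originates from, and the node adopts the information of the highest priority among those it receives at time $t$ (and passes on that information with its originating seed). $\sigma_\tau(S,A)$ denotes the expected number of nodes that are negatively activated by time $\tau$ when $S$ and $A$ propagate simultaneously, and $\sigma_\tau(S,\varnothing)$ the same quantity when only $S$ propagates. The TC-AIBM problem is to maximize $\sigma^-_\tau(A)$ over $A\subseteq V\setminus S$ with $|A|\le k$. *)

(* Defs.v *)
From HB Require Import structures.
From mathcomp Require Import all_boot all_order all_algebra reals.

Set Implicit Arguments.
Unset Strict Implicit.
Unset Printing Implicit Defensive.

Import Order.TTheory GRing.Theory Num.Theory.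
Local Open Scope ring_scope.

(* Cascade of pieces of information (of type [I]) along the edges of a fixed
   live-edge graph.  A node is either inactive ([None]) or was activated at
   time [t] by adopting information [i] ([Some (t, i)]).  [resolve M] is the
   information adopted by an inactive node receiving exactly the set [M] of
   pieces of information; it is [None] when [M] is empty. *)
Section Cascade.
Variables (V I : finType) (resolve : {set I} -> option I).
Variable (L : {set V * V}).

Definition cascade_state : Type := V -> option (nat * I).

Definition received (t : nat) (st : cascade_state) (v : V) : {set I} :=
  [set i | [exists u, ((u, v) \in L) && (st u == Some (t.-1, i))]].

Definition cascade_step (t : nat) (st : cascade_state) : cascade_state :=
  fun v => if st v is Some a then Some a
           else omap (pair t) (resolve (received t st v)).

Fixpoint cascade (init : cascade_state) (t : nat) : cascade_state :=
  if t is t'.+1 then cascade_step t (cascade init t') else init.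

End Cascade.

Section TimeCriticalIC.
Variable V : finType.

(* A larger value of [gamma] means a higher priority. *)
Inductive tie_breaking : Type :=
| PositiveDominance
| NegativeDominance
| FixedDominance (d : Order.disp_t) (O : orderType d) (gamma : V -> O)
    of injective gamma.

(* Under Positive and Negative Dominance the information is just its type. *)
Definition positive : bool := true.
Definition negative : bool := false.

Definition resolve_dominant (dom : bool) (M : {set bool}) : option bool :=
  if dom \in M then Some dom
  else if ~~ dom \in M then Some (~~ dom) else None.

(* Under Fixed Dominance the information is the seed it originates from. *)
Definition resolve_fixed (d : Order.disp_t) (O : orderType d) (gamma : V -> O)
    (M : {set V}) : option V :=
  [pick s in M | [forall s' in M, (gamma s' <= gamma s)%O]].

Definition typed_seeds (S A : {set V}) : cascade_state V bool :=
  fun v => if v \in S then Some (0%N, negative)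
           else if v \in A then Some (0%N, positive) else None.

Definition origin_seeds (S A : {set V}) : cascade_state V V :=
  fun v => if v \in S :|: A then Some (0%N, v) else None.

Definition neg_activated_typed (dom : bool) (L : {set V * V}) (tau : nat)
    (S A : {set V}) : {set V} :=
  [set v | if cascade (resolve_dominant dom) L (typed_seeds S A) tau v
             is Some (_, i) then i == negative else false].

Definition neg_activated_fixed (d : Order.disp_t) (O : orderType d)
    (gamma : V -> O) (L : {set V * V}) (tau : nat) (S A : {set V}) : {set V} :=
  [set v | if cascade (resolve_fixed gamma) L (origin_seeds S A) tau v
             is Some (_, s) then s \in S else false].

Definition neg_activated (rule : tie_breaking) (L : {set V * V}) (tau : nat)
    (S A : {set V}) : {set V} :=
  match rule with
  | PositiveDominance => neg_activated_typed positive L tau S A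
  | NegativeDominance => neg_activated_typed negative L tau S A
  | FixedDominance _ _ gamma _ => neg_activated_fixed gamma L tau S A
  end.

Variables (R : realType) (E : {set V * V}) (p : V * V -> R).

(* For [L] a subset of [E]: each edge of [E] is live independently. *)
Definition live_edge_prob (L : {set V * V}) : R :=
  \prod_(e in L) p e * \prod_(e in E :\: L) (1 - p e).

Definition sigma (rule : tie_breaking) (tau : nat) (S A : {set V}) : R :=
  \sum_(L : {set V * V} | L \subset E)
     live_edge_prob L * #|neg_activated rule L tau S A|%:R.

Definition sigma_minus (rule : tie_breaking) (tau : nat) (S A : {set V}) : R :=
  sigma rule tau S set0 - sigma rule tau S A.

(* Only the values of [f] at subsets of the ground set [D] matter. *)
Definition submodular_on (D : {set V}) (f : {set V} -> R) : Prop :=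
  forall (A B : {set V}) (x : V),
    A \subset B -> B \subset D -> x \in D :\: B ->
    f (A :|: [set x]) - f A >= f (B :|: [set x]) - f B.

End TimeCriticalIC.

(* Main.v *)
(** Fix a live-edge graph.  Order the possible outcomes at a node
    lexicographically: earlier activation first, then higher priority of the
    information, inactivity last.  The outcome of a cascade started from two
    seed sets together is, at every node, the better of the two separate
    outcomes.  Hence a node is negative under [(S, A)] iff its outcome from [S]
    alone is at least as good as its outcome from [A] alone, so that the set
    [N A] of negative nodes satisfies [N (A :|: B) = N A :&: N B].  Then
    [N A :\: N (A :|: [set x]) = N A :\: N [set x]] shrinks as [A] grows, and
    averaging over live-edge graphs preserves the resulting inequality. *)
Require Import Defs.
From HB Require Import structures.
From mathcomp Require Import all_boot all_order all_algebra reals.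

Set Implicit Arguments.
Unset Strict Implicit.
Unset Printing Implicit Defensive.

Import Order.TTheory GRing.Theory Num.Theory.
Local Open Scope ring_scope.

(** * Tie-breaking as maximisation of a priority *)

Section Resolve.
Variables (I : finType) (d : Order.disp_t) (O : orderType d) (g : I -> O).

Variant resolve_fixed_spec (M : {set I}) : option I -> Prop :=
| ResolveSome i of i \in M & (forall j, j \in M -> (g j <= g i)%O) :
    resolve_fixed_spec M (Some i)
| ResolveNone of M = set0 : resolve_fixed_spec M None.

Lemma resolve_fixedP (M : {set I}) : resolve_fixed_spec M (resolve_fixed g M).
Proof.
rewrite /resolve_fixed; case: pickP => [i /andP[iM /forall_inP imax]|noM].
  exact: ResolveSome.
apply: ResolveNone; apply/eqP; apply/set0Pn => -[i0 i0M].
have [i iM imax] := Order.TotalTheory.arg_maxP g i0M.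
by have /negP[] := noM i; apply/andP; split=> //; apply/forall_inP.
Qed.

Lemma resolve_fixedE (g_inj : injective g) (M : {set I}) (i : I) :
  i \in M -> (forall j, j \in M -> (g j <= g i)%O) ->
  resolve_fixed g M = Some i.
Proof.
move=> iM imax; case: resolve_fixedP => [j jM jmax|M0]; last first.
  by rewrite M0 inE in iM.
by congr Some; apply: g_inj; apply: le_anti; rewrite imax // jmax.
Qed.

End Resolve.

(** Under [pred1 dom] the dominant type gets [true], the larger boolean, so dominance is a fixed
    priority on two pieces of information. One argument then covers all three rules. *)
Lemma resolve_dominantE (dom : bool) (M : {set bool}) :
  resolve_dominant dom M = resolve_fixed (pred1 dom : bool -> bool) M.
Proof.
rewrite /resolve_dominant; have g_inj : injective (pred1 dom : bool -> bool).
  by case: dom => -[] [].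
have [domM|domM] := boolP (dom \in M).
  by apply/esym/resolve_fixedE => // j _; rewrite /= eqxx lex1.
have Mdom j : j \in M -> j = ~~ dom.
  by case: (eqVneq j dom) => [->|+ _]; [rewrite (negPf domM)|case: j; case: (dom)].
have [ndomM|ndomM] := boolP (~~ dom \in M).
  by apply/esym/resolve_fixedE => // j /Mdom->.
by case: resolve_fixedP => // i iM _; rewrite -(Mdom i iM) iM in ndomM.
Qed.

(** * The lexicographic order on outcomes *)

Section Merge.
Variables (V I : finType) (d : Order.disp_t) (O : orderType d) (g : I -> O).
Hypothesis g_inj : injective g.

Definition precedes (a b : option (nat * I)) : bool :=
  match a, b with
  | _, None => true
  | None, Some _ => false
  | Some (k, i), Some (l, j) => (k < l)%N || (k == l) && (g j <= g i)%O
  end.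

Definition merge (a b : option (nat * I)) : option (nat * I) :=
  if precedes a b then a else b.

Lemma precedes_total : total precedes.
Proof.
move=> [[k i]|] [[l j]|] //=.
by case: (ltngtP k l) => //= _; exact: le_total.
Qed.

Lemma precedes_trans : transitive precedes.
Proof.
move=> [[l j]|] [[k i]|] [[m h]|] //=.
case/orP=> [kl|/andP[/eqP<- ji]] /orP[lm|/andP[/eqP<- hj]].
- by rewrite (ltn_trans kl lm).
- by rewrite kl.
- by rewrite lm.
- by rewrite eqxx (le_trans hj ji) orbT.
Qed.

Lemma precedes_anti : antisymmetric precedes.
Proof.
move=> [[k i]|] [[l j]|] //=.
case: (ltngtP k l) => //= -> /le_anti; by move/g_inj->.
Qed.

(** Injectivity of [g] enters here through antisymmetry: outcomes tied in time and priority
    coincide. The two runs can then be exchanged freely. *)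
Lemma mergeC : commutative merge.
Proof.
move=> a b; rewrite /merge; case: ifPn => ab; case: ifPn => ba //.
  by apply: precedes_anti; rewrite ab ba.
by have := precedes_total a b; rewrite (negPf ab) (negPf ba).
Qed.

Lemma precedes_mergel a b : precedes (merge a b) a.
Proof.
rewrite /merge; case: ifPn => ab.
  by have := precedes_total a a; rewrite orbb.
by have := precedes_total a b; rewrite (negPf ab).
Qed.

Lemma precedes_merge s a b :
  precedes s (merge a b) = precedes s a && precedes s b.
Proof.
apply/idP/andP => [sab|[sa sb]]; last by rewrite /merge; case: ifP.
split; apply: precedes_trans sab _; first exact: precedes_mergel.
by rewrite mergeC precedes_mergel.
Qed.

Lemma merge_cases a b : merge a b = a \/ merge a b = b.
Proof. by rewrite /merge; case: ifP; [left|right]. Qed.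

Lemma precedesb0 a : precedes a None.
Proof. by case: a => [[]|]. Qed.

Lemma mergeb0 a : merge a None = a.
Proof. by rewrite /merge precedesb0. Qed.

Lemma mergebb a : merge a a = a.
Proof. by rewrite /merge if_same. Qed.

(** * Cascades on one live-edge graph *)

Variable L : {set V * V}.
Local Notation casc := (cascade (resolve_fixed g) L).

Definition at_time0 (init : cascade_state V I) : Prop :=
  forall v k i, init v = Some (k, i) -> k = 0%N.

Lemma cascade_time init t v k i :
  at_time0 init -> casc init t v = Some (k, i) -> (k <= t)%N.
Proof.
move=> init0; elim: t k i => [|t IH] k i /=; first by move/init0->.
rewrite /cascade_step; case E: (casc init t v) => [[l j]|].
  by case=> <- _; apply: leqW; exact: IH E.
by case: (resolve_fixed g _) => //= j [<-].
Qed.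

Lemma cascade_info init (Q : pred I) t v k i :
  (forall w l j, init w = Some (l, j) -> Q j) ->
  casc init t v = Some (k, i) -> Q i.
Proof.
move=> initQ; elim: t v k i => [|t IH] v k i /=; first exact: initQ.
rewrite /cascade_step; case E: (casc init t v) => [[l j]|].
  by case=> _ <-; exact: IH E.
case: resolve_fixedP => //= j + _ [_ <-].
by rewrite inE => /existsP[u /andP[_ /eqP/IH]].
Qed.

(** The attempt along a live edge, made one step after [u] is activated, either finds [v] active or
    gives it a nonempty set to resolve. *)
Lemma cascade_reaches init t u v k i :
  at_time0 init -> (u, v) \in L -> casc init t u = Some (k, i) ->
  (k < t)%N -> casc init t v <> None.
Proof.
move=> init0 uvL; elim: t => //= t IH; rewrite /cascade_step ltnS.
case Eu: (casc init t u) => [[l j]|].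
  case=> lk ji; subst l j => le_kt; case Ev: (casc init t v) => [a|] //.
  have k_t : k = t.
    apply/eqP; rewrite eqn_leq le_kt leqNgt; apply/negP => lt_kt.
    exact: IH Eu lt_kt Ev.
  case: resolve_fixedP => //= M0; have : i \in set0; last by rewrite inE.
  rewrite -M0 inE; apply/existsP; exists u.
  by rewrite uvL Eu k_t eqxx.
by case: (resolve_fixed g _) => //= j [<- _]; rewrite ltnn.
Qed.

(** Had the second run activated the sender before time [t], it would have reached [v] by now. So
    merging can only replace what the sender passes on by information of the same time and higher
    priority. *)
Lemma received_merge init init1 init2 t v i :
  at_time0 init1 -> at_time0 init2 ->
  (forall u, casc init t u = merge (casc init1 t u) (casc init2 t u)) ->
  casc init2 t v = None ->
  i \in received L t.+1 (casc init1 t) v ->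
  exists2 j, j \in received L t.+1 (casc init t) v & (g i <= g j)%O.
Proof.
move=> z1 z2 Em v2; rewrite inE => /existsP[u /andP[uvL /eqP/= u1]].
have [j uj ij] : exists2 j, casc init t u = Some (t, j) & (g i <= g j)%O.
  rewrite Em u1 /merge; case u2: (casc init2 t u) => [[k j]|] /=; last first.
    by exists i.
  have le_kt := cascade_time z2 u2.
  have k_t : k = t.
    apply/eqP; rewrite eqn_leq le_kt leqNgt; apply/negP => lt_kt.
    exact: cascade_reaches z2 uvL u2 lt_kt v2.
  rewrite k_t ltnn eqxx /=; case: leP => [ji|/ltW ij].
    by exists i.
  by exists j.
by exists j => //; rewrite inE; apply/existsP; exists u; rewrite uvL uj /=.
Qed.

(** The joint run may lose information that was beaten at its sender, so [M] can be smaller than the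
    union. Domination ensures that the maximum survives. *)
Lemma resolve_received_merge (t : nat) (M M1 M2 : {set I}) :
  M \subset M1 :|: M2 ->
  (forall i, i \in M1 -> exists2 j, j \in M & (g i <= g j)%O) ->
  (forall i, i \in M2 -> exists2 j, j \in M & (g i <= g j)%O) ->
  omap (pair t) (resolve_fixed g M) =
  merge (omap (pair t) (resolve_fixed g M1)) (omap (pair t) (resolve_fixed g M2)).
Proof.
move=> /subsetP sM d1 d2.
case: (resolve_fixedP g M) => [i iM imax|M0].
- have ge1 j : j \in M1 -> (g j <= g i)%O.
    by move=> /d1[h /imax hi jh]; exact: le_trans jh hi.
  have ge2 j : j \in M2 -> (g j <= g i)%O.
    by move=> /d2[h /imax hi jh]; exact: le_trans jh hi.
  have worse (N : {set I}) : (forall j, j \in N -> (g j <= g i)%O) ->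
      precedes (Some (t, i)) (omap (pair t) (resolve_fixed g N)).
    move=> geN; case: resolve_fixedP => //= j jN _.
    by rewrite ltnn eqxx geN.
  have /setUP[iM1|iM2] := sM _ iM.
    by rewrite (resolve_fixedE g_inj iM1 ge1) /= /merge worse.
  by rewrite (resolve_fixedE g_inj iM2 ge2) /= mergeC /merge worse.
- have empty (N : {set I}) : (forall i, i \in N -> exists2 j, j \in M & (g i <= g j)%O) ->
      resolve_fixed g N = None.
    move=> dN; case: resolve_fixedP => // i /dN[j].
    by rewrite M0 inE.
  by rewrite (empty _ d1) (empty _ d2).
Qed.

Lemma merge_early t a (o : option I) :
  (a.1 <= t)%N -> merge (Some a) (omap (pair t.+1) o) = Some a.
Proof. by case: a o => k i [j|] //= le_kt; rewrite /merge /= ltnS le_kt. Qed.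

(** Induction on time. An activation already recorded beats any made at the current step, so only a
    node inactive in both runs requires comparing received sets. *)
Lemma cascade_merge init init1 init2 :
  at_time0 init1 -> at_time0 init2 ->
  (forall v, init v = merge (init1 v) (init2 v)) ->
  forall t v, casc init t v = merge (casc init1 t v) (casc init2 t v).
Proof.
move=> z1 z2 init12; elim=> [//|t IH] v /=; rewrite /cascade_step IH.
case E1: (casc init1 t v) => [[k i]|]; case E2: (casc init2 t v) => [[l j]|].
- by have [-> | ->] := merge_cases (Some (k, i)) (Some (l, j)).
- by rewrite mergeb0 merge_early //=; exact: cascade_time E1.
- by rewrite !(mergeC _ (Some _)) mergeb0 merge_early //=; exact: cascade_time E2.
rewrite mergeb0; apply: resolve_received_merge.
- apply/subsetP => i; rewrite !inE => /existsP[u /andP[uvL /eqP]].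
  rewrite IH => Eu; apply/orP.
  by have [Em|Em] := merge_cases (casc init1 t u) (casc init2 t u);
    [left|right]; apply/existsP; exists u; rewrite uvL -Em Eu /=.
- by move=> i; exact: (received_merge z1 z2).
- by move=> i; apply: (received_merge z2 z1) => // u; rewrite IH mergeC.
Qed.

Definition adopts (neg : pred I) (a : option (nat * I)) : bool :=
  if a is Some (_, i) then neg i else false.

(** The test [s != None] excludes the node that neither run reaches, where [precedes] holds between
    two inactive outcomes. *)
Lemma adopts_merge (neg : pred I) s a :
  (forall k i, s = Some (k, i) -> neg i) ->
  (forall k i, a = Some (k, i) -> ~~ neg i) ->
  adopts neg (merge s a) = (s != None) && precedes s a.
Proof.
move=> sneg apos; rewrite /merge; case: ifP => _.
  by case: s sneg => [[k i]|] //= /(_ k i erefl) ->.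
by rewrite andbF; case: a apos => [[k i]|] //= /(_ k i erefl) /negPf.
Qed.

(** The outcome from [S] precedes a merged outcome iff it precedes both components. Keeping [seeds]
    abstract serves both encodings of information. *)
Lemma negative_setU (neg : pred I) (seeds : {set V} -> {set V} -> cascade_state V I)
    (S : {set V}) (t : nat) (A B : {set V}) (v : V) :
  (forall X Y, at_time0 (seeds X Y)) ->
  (forall w k i, seeds S set0 w = Some (k, i) -> neg i) ->
  (forall (Y : {set V}) w k i, Y \subset ~: S -> seeds set0 Y w = Some (k, i) -> ~~ neg i) ->
  (forall (Y : {set V}) w, Y \subset ~: S ->
     seeds S Y w = merge (seeds S set0 w) (seeds set0 Y w)) ->
  (forall w, seeds set0 (A :|: B) w = merge (seeds set0 A w) (seeds set0 B w)) ->
  A \subset ~: S -> B \subset ~: S ->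
  adopts neg (casc (seeds S (A :|: B)) t v) =
  adopts neg (casc (seeds S A) t v) && adopts neg (casc (seeds S B) t v).
Proof.
move=> z Sneg pos split splitU AS BS.
have ABS : A :|: B \subset ~: S by rewrite subUset AS.
have adoptsE (Y : {set V}) : Y \subset ~: S -> adopts neg (casc (seeds S Y) t v) =
    (casc (seeds S set0) t v != None) &&
    precedes (casc (seeds S set0) t v) (casc (seeds set0 Y) t v).
  move=> YS; rewrite (cascade_merge (z S set0) (z set0 Y)) => [|w]; last exact: split.
  rewrite adopts_merge // => k i; first exact: cascade_info.
  by apply: (cascade_info (Q := predC neg)) => w l j; exact: pos.
rewrite !adoptsE // (cascade_merge (z set0 A) (z set0 B) splitU) precedes_merge.
by case: (_ == None).
Qed.

End Merge.

(** * The three rules, and averaging over live-edge graphs *)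

Lemma eq_cascade (V I : finType) (r1 r2 : {set I} -> option I)
    (L : {set V * V}) (init : cascade_state V I) (t : nat) (v : V) :
  r1 =1 r2 -> cascade r1 L init t v = cascade r2 L init t v.
Proof.
move=> r12; elim: t v => //= t IH v; rewrite /cascade_step IH r12.
case: (cascade r2 L init t v) => //; congr (omap _ (r2 _)).
by apply/setP => i; rewrite !inE; apply: eq_existsb => u; rewrite IH.
Qed.

Lemma neg_activated_setU (V : finType) (rule : tie_breaking V)
    (L : {set V * V}) (tau : nat) (S A B : {set V}) :
  A \subset ~: S -> B \subset ~: S ->
  neg_activated rule L tau S (A :|: B) =
  neg_activated rule L tau S A :&: neg_activated rule L tau S B.
Proof.
move=> AS BS.
have typed dom : neg_activated_typed dom L tau S (A :|: B) =
    neg_activated_typed dom L tau S A :&: neg_activated_typed dom L tau S B.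
  have g_inj : injective (pred1 dom : bool -> bool) by case: dom => -[] [].
  apply/setP => v; rewrite !inE !(eq_cascade _ _ _ _ (resolve_dominantE dom)).
  apply: (negative_setU g_inj L (neg := pred1 negative)) => //.
  - by move=> X Y w k i; rewrite /typed_seeds; do 2?case: ifP => // _; case.
  - by move=> w k i; rewrite /typed_seeds !inE; case: ifP => // _ [_ <-].
  - by move=> Y w k i _; rewrite /typed_seeds !inE; case: ifP => // _ [_ <-].
  (* A seed in both sets would start negative jointly, yet merging could make it positive;
     disjointness from [S] rules this out. *)
  - move=> Y w /subsetP/(_ w); rewrite /typed_seeds !inE.
    by case: (w \in S); case: (w \in Y) => // /(_ isT).
  - move=> w; rewrite /typed_seeds !inE.
    by case: (w \in A); case: (w \in B); rewrite ?mergebb.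
case: rule => [||d O g g_inj]; [exact: typed|exact: typed|].
apply/setP => v; rewrite !inE.
apply: (negative_setU g_inj L (neg := mem S)) => //.
- by move=> X Y w k i; rewrite /origin_seeds; case: ifP => // _; case.
- by move=> w k i; rewrite /origin_seeds setU0; case: ifP => // wS [_ <-].
- move=> Y w k i /subsetP YS; rewrite /origin_seeds set0U.
  by case: ifP => // /YS + [_ <-]; rewrite inE.
(* Here a common seed carries the same information in both runs, so idempotence of [merge]
   suffices. *)
- move=> Y w _; rewrite /origin_seeds !inE /=.
  by case: (w \in S); case: (w \in Y); rewrite ?mergebb.
- move=> w; rewrite /origin_seeds !inE /=.
  by case: (w \in A); case: (w \in B); rewrite ?mergebb.
Qed.

(** Each difference counts the elements outside [X]. *)
Lemma card_setI_marginal (R : numDomainType) (T : finType) (N N' X : {set T}) :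
  N' \subset N ->
  #|N'|%:R - #|N' :&: X|%:R <= #|N|%:R - #|N :&: X|%:R :> R.
Proof.
move=> N'N; rewrite -(cardsID X N') -(cardsID X N) !natrD.
by rewrite !(addrAC _ _ (- _)) !subrr !add0r ler_nat subset_leq_card // setSD.
Qed.

Lemma live_edge_prob_ge0 (R : realType) (V : finType) (E L : {set V * V})
    (p : V * V -> R) :
  (forall e, e \in E -> 0 <= p e <= 1) -> L \subset E ->
  0 <= live_edge_prob E p L.
Proof.
move=> hp /subsetP LE; apply: mulr_ge0; apply: prodr_ge0 => e.
  by move=> /LE/hp/andP[].
by rewrite inE => /andP[_ /hp/andP[_]]; rewrite subr_ge0.
Qed.

Theorem theorem1 (R : realType) (V : finType) (E : {set V * V})
    (p : V * V -> R) (hp : forall e, e \in E -> 0 <= p e <= 1)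
    (S : {set V}) (tau : nat) (rule : tie_breaking V) :
  submodular_on (~: S) (sigma_minus E p rule tau S).
Proof.
move=> A B x AB BS /setDP[xS _].
have AS := subset_trans AB BS.
have xS1 : [set x] \subset ~: S by rewrite sub1set.
have cancel (s a b : R) : s - a - (s - b) = b - a.
  by rewrite opprB addrC addrA subrK.
rewrite /sigma_minus !cancel /sigma -!sumrB; apply: ler_sum => L LE.
rewrite -!mulrBr; apply: ler_wpM2l; first exact: live_edge_prob_ge0.
rewrite !neg_activated_setU //; apply: card_setI_marginal.
(* Antitonicity of the negative set also follows from the intersection law, on writing [B] as
   [A :|: B]. *)
by rewrite -(setUidPr AB) neg_activated_setU // subsetIl.
Qed.
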